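(* Assume $\mathrm{CH}$. Let $\mathbb B$ be a Boolean algebra of size $\mathfrak c$ with $\mathfrak u(\mathbb B)>\omega$, and let $S\subseteq\mathrm{Aut}(\mathbb B)\setminus\{\mathrm{id}\}$ with $|S|\le\mathfrak c$. Then there is an embedding $e:\mathbb B\to\mathcal P(\mathbb N)/\mathrm{fin}$ such that no $h\in S$ can be extended to an automorphism of $\mathcal P(\mathbb N)/\mathrm{fin}$, i.e. for no $h\in S$ is there an automorphism $\bar h$ of $\mathcal P(\mathbb N)/\mathrm{fin}$ with $\bar h\circ e=e\circ h$.
   Context: $\mathrm{CH}$ is the Continuum Hypothesis, $\mathfrak c=2^{\aleph_0}$. $\mathcal P(\mathbb N)/\mathrm{fin}$ is the Boolean algebra of subsets of $\mathbb N$ modulo finite sets; an embedding is an injective Boolean homomorphism. $\mathfrak u(\mathbb B)$ is the minimal character of an ultrafilter on $\mathbb B$; $\mathfrak u(\mathbb B)>\omega$ means no ultrafilter on $\mathbb B$ is countably generated. *)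

(* Defs.v *)
From HB Require Import structures.
From mathcomp Require Import all_boot all_order.
From mathcomp Require Import boolp classical_sets functions cardinality.

Set Implicit Arguments.
Unset Strict Implicit.
Unset Printing Implicit Defensive.

Import Order.TTheory.

Local Open Scope classical_set_scope.
Local Open Scope card_scope.
Local Open Scope quotient_scope.

(* Boolean algebras are MathComp's [ctbDistrLatticeType]. *)

(* MathComp's [{tblmorphism _ -> _}] only preserves \bot and \top. *)
Record boolean_hom (d d' : Order.disp_t) (B : ctbDistrLatticeType d)
    (B' : ctbDistrLatticeType d') (f : B -> B') : Prop := BooleanHom {
  boolean_homI : {morph f : x y / (x `&` y)%O};
  boolean_homU : {morph f : x y / (x `|` y)%O};
  boolean_homC : {morph f : x / (~` x)%O};
  boolean_hom0 : f \bot%O = \bot%O;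
  boolean_hom1 : f \top%O = \top%O }.

Definition boolean_embedding (d d' : Order.disp_t) (B : ctbDistrLatticeType d)
    (B' : ctbDistrLatticeType d') (f : B -> B') : Prop :=
  boolean_hom f /\ injective f.

Definition boolean_aut (d : Order.disp_t) (B : ctbDistrLatticeType d) :
    set (B -> B) :=
  [set f | boolean_hom f /\ bijective f].
Arguments boolean_aut {d} B.

Section Filters.
Context {d : Order.disp_t} {B : ctbDistrLatticeType d}.

Record boolean_filter (F : set B) : Prop := BooleanFilter {
  boolean_filterT : F \top%O;
  boolean_filterI : forall x y, F x -> F y -> F (x `&` y)%O;
  boolean_filterS : forall x y, (x <= y)%O -> F x -> F y }.

Definition proper_boolean_filter (F : set B) : Prop :=
  boolean_filter F /\ ~ F \bot%O.

Definition boolean_ultrafilter (U : set B) : Prop :=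
  proper_boolean_filter U /\
  forall F : set B, proper_boolean_filter F -> U `<=` F -> F = U.

Definition filter_generated (G : set B) : set B := smallest boolean_filter G.

Definition countably_generated (F : set B) : Prop :=
  exists G : set B, countable G /\ F = filter_generated G.

End Filters.

(* u(B) > omega; generating sets may be finite, as [countable] allows. *)
Definition ultrafilter_number_uncountable (d : Order.disp_t)
    (B : ctbDistrLatticeType d) : Prop :=
  forall U : set B, boolean_ultrafilter U -> ~ countably_generated U.

Definition has_size_continuum (T : Type) : Prop :=
  [set: T] #= [set: set nat].

Definition CH : Prop :=
  forall A : set (set nat), countable A \/ A #= [set: set nat].

(* The Boolean algebra P(N)/fin *)

Definition eqfin (A B : set nat) : bool := `[< finite_set (A `+` B) >].

Lemma eqfin_refl : reflexive eqfin.
Proof. by move=> A; apply/asboolP; rewrite setYK; exact: finite_set0. Qed.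

Lemma eqfin_sym : symmetric eqfin.
Proof. by move=> A B; rewrite /eqfin setYC. Qed.

Lemma eqfin_trans : transitive eqfin.
Proof.
move=> B A C /asboolP AB /asboolP BC; apply/asboolP.
apply: (@sub_finite_set _ _ ((A `+` B) `|` (B `+` C)));
  last by rewrite finite_setU.
move=> x [[Ax nCx]|[Cx nAx]]; have [Bx|nBx] := pselect (B x).
- by right; left.
- by left; left.
- by left; right.
- by right; right.
Qed.

Canonical eqfin_equiv := EquivRel eqfin eqfin_refl eqfin_sym eqfin_trans.

Definition pfin : Type := {eq_quot eqfin}.

HB.instance Definition _ := Choice.on pfin.
HB.instance Definition _ := EqQuotient.on pfin.

Definition pfin_set0 : pfin := \pi_pfin set0.
Definition pfin_setT : pfin := \pi_pfin setT.
Definition pfin_setC : pfin -> pfin := lift_op1 pfin (@setC nat).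
Definition pfin_setI : pfin -> pfin -> pfin := lift_op2 pfin (@setI nat).
Definition pfin_setU : pfin -> pfin -> pfin := lift_op2 pfin (@setU nat).
Definition pfin_setD : pfin -> pfin -> pfin := lift_op2 pfin (@setD nat).

Lemma pfin_eqP (A B : set nat) :
  \pi_pfin A = \pi_pfin B <-> finite_set (A `+` B).
Proof.
by split=> [/eqmodP/asboolP|?] //; apply/eqmodP/asboolP.
Qed.

Lemma pfin_reprP (A : set nat) : finite_set (repr (\pi_pfin A) `+` A).
Proof. by apply/pfin_eqP; rewrite reprK. Qed.

Lemma pfin_setCE (A : set nat) : pfin_setC (\pi_pfin A) = \pi_pfin (~` A).
Proof.
unlock pfin_setC.
apply/pfin_eqP; apply: sub_finite_set (pfin_reprP A) => x [[p q]|[p q]].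
- by right; split=> //; apply: contrapT.
- by left; split=> //; apply: contrapT.
Qed.

Lemma pfin_op2 (op : set nat -> set nat -> set nat) (A B : set nat) :
  (forall A' B', op A' B' `+` op A B `<=` (A' `+` A) `|` (B' `+` B)) ->
  \pi_pfin (op (repr (\pi_pfin A)) (repr (\pi_pfin B))) = \pi_pfin (op A B).
Proof.
move=> H; apply/pfin_eqP; apply: sub_finite_set (H _ _) _.
by rewrite finite_setU; split; exact: pfin_reprP.
Qed.

Lemma pfin_setIE (A B : set nat) :
  pfin_setI (\pi_pfin A) (\pi_pfin B) = \pi_pfin (A `&` B).
Proof.
unlock pfin_setI; apply: (pfin_op2 (op := @setI nat)) => A' B' x.
rewrite /setY /setD /setI /setU /=.
have [|] := pselect (A x); have [|] := pselect (B x);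
have [|] := pselect (A' x); have [|] := pselect (B' x); tauto.
Qed.

Lemma pfin_setUE (A B : set nat) :
  pfin_setU (\pi_pfin A) (\pi_pfin B) = \pi_pfin (A `|` B).
Proof.
unlock pfin_setU; apply: (pfin_op2 (op := @setU nat)) => A' B' x.
rewrite /setY /setD /setI /setU /=.
have [|] := pselect (A x); have [|] := pselect (B x);
have [|] := pselect (A' x); have [|] := pselect (B' x); tauto.
Qed.

Lemma pfin_setDE (A B : set nat) :
  pfin_setD (\pi_pfin A) (\pi_pfin B) = \pi_pfin (A `\` B).
Proof.
unlock pfin_setD; apply: (pfin_op2 (op := @setD nat)) => A' B' x.
rewrite /setY /setD /setI /setU /=.
have [|] := pselect (A x); have [|] := pselect (B x);
have [|] := pselect (A' x); have [|] := pselect (B' x); tauto.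
Qed.

Definition pfinE := (pfin_setIE, pfin_setUE, pfin_setDE, pfin_setCE).

Fact pfin_display : Order.disp_t. Proof. by []. Qed.

Definition pfin_le (x y : pfin) : bool := pfin_setI x y == x.
Definition pfin_lt (x y : pfin) : bool := (y != x) && pfin_le x y.

Section PfinLattice.
Implicit Types x y z : pfin.

Lemma pfin_setIC : commutative pfin_setI.
Proof. by elim/quotW=> A; elim/quotW=> B; rewrite !pfinE setIC. Qed.

Lemma pfin_setUC : commutative pfin_setU.
Proof. by elim/quotW=> A; elim/quotW=> B; rewrite !pfinE setUC. Qed.

Lemma pfin_setIA : associative pfin_setI.
Proof.
by elim/quotW=> A; elim/quotW=> B; elim/quotW=> C; rewrite !pfinE setIA.
Qed.

Lemma pfin_setUA : associative pfin_setU.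
Proof.
by elim/quotW=> A; elim/quotW=> B; elim/quotW=> C; rewrite !pfinE setUA.
Qed.

Lemma pfin_setKI y x : pfin_setI x (pfin_setU x y) = x.
Proof.
by elim/quotW: x => A; elim/quotW: y => B; rewrite !pfinE setUC setKU.
Qed.

Lemma pfin_setKU y x : pfin_setU x (pfin_setI x y) = x.
Proof.
by elim/quotW: x => A; elim/quotW: y => B; rewrite !pfinE setIC setKI.
Qed.

Lemma pfin_setIUl : left_distributive pfin_setI pfin_setU.
Proof.
by elim/quotW=> A; elim/quotW=> B; elim/quotW=> C; rewrite !pfinE setIUl.
Qed.

Lemma pfin_setIid : idempotent_op pfin_setI.
Proof. by elim/quotW=> A; rewrite !pfinE setIid. Qed.

HB.instance Definition _ :=
  Order.isMeetJoinDistrLattice.Build pfin_display pfin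
    (fun _ _ => erefl) (fun _ _ => erefl)
    pfin_setIC pfin_setUC pfin_setIA pfin_setUA
    pfin_setKI pfin_setKU pfin_setIUl pfin_setIid.

Lemma pfin_le0x x : (pfin_set0 <= x)%O.
Proof.
apply/eqP; change (pfin_setI pfin_set0 x = pfin_set0).
by elim/quotW: x => A; rewrite /pfin_set0 pfinE set0I.
Qed.

Lemma pfin_lex1 x : (x <= pfin_setT)%O.
Proof.
apply/eqP; change (pfin_setI x pfin_setT = x).
by elim/quotW: x => A; rewrite /pfin_setT pfinE setIT.
Qed.

HB.instance Definition _ := Order.hasBottom.Build pfin_display pfin pfin_le0x.
HB.instance Definition _ := Order.hasTop.Build pfin_display pfin pfin_lex1.

Lemma pfin_setDKI x y : pfin_setI y (pfin_setD x y) = pfin_set0.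
Proof.
elim/quotW: x => A; elim/quotW: y => B; rewrite !pfinE.
by rewrite setDE setICA setICr setI0.
Qed.

Lemma pfin_setUIB x y : pfin_setU (pfin_setI x y) (pfin_setD x y) = x.
Proof.
elim/quotW: x => A; elim/quotW: y => B; rewrite !pfinE.
by rewrite setUC -setDDr setDv setD0.
Qed.

HB.instance Definition _ :=
  Order.BDistrLattice_hasSectionalComplement.Build pfin_display pfin
    pfin_setDKI pfin_setUIB.

Lemma pfin_setTD x : pfin_setC x = pfin_setD pfin_setT x.
Proof. by elim/quotW: x => A; rewrite /pfin_setT !pfinE setTD. Qed.

HB.instance Definition _ :=
  Order.CBDistrLattice_hasComplement.Build pfin_display pfin pfin_setTD.

End PfinLattice.

Lemma pfin_meetE (A B : set nat) :
  (\pi_pfin A `&` \pi_pfin B)%O = \pi_pfin (A `&` B).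
Proof. exact: pfin_setIE. Qed.

Lemma pfin_joinE (A B : set nat) :
  (\pi_pfin A `|` \pi_pfin B)%O = \pi_pfin (A `|` B).
Proof. exact: pfin_setUE. Qed.

Lemma pfin_complE (A : set nat) : (~` \pi_pfin A)%O = \pi_pfin (~` A).
Proof. exact: pfin_setCE. Qed.

Lemma pfin_botE : \bot%O = \pi_pfin set0. Proof. by []. Qed.

Lemma pfin_topE : \top%O = \pi_pfin setT. Proof. by []. Qed.

Lemma pfin_leP (A B : set nat) :
  (\pi_pfin A <= \pi_pfin B :> pfin)%O <-> finite_set (A `\` B).
Proof.
have -> : A `\` B = (A `&` B) `+` A.
  rewrite eqEsubset /setY /setD /setI /setU; split=> x /=;
    have [|] := pselect (A x); have [|] := pselect (B x); tauto.
rewrite -pfin_eqP -pfin_setIE; split=> [/eqP|?]; [by []|exact/eqP].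
Qed.

(* Main.v *)
Require Import Defs.
From Stdlib Require Wellfounded.Inverse_Image.
From mathcomp Require Import all_boot all_order.
From mathcomp Require Import boolp classical_sets functions cardinality wochoice.

Set Implicit Arguments.
Unset Strict Implicit.
Unset Printing Implicit Defensive.

Import Order.Theory.

Local Open Scope classical_set_scope.
Local Open Scope card_scope.
Local Open Scope quotient_scope.

(** An extension of [h] carries lower bounds of [e[U]] to lower bounds of
    [e[h[U]]], for [U] an ultrafilter on [B]. So it is enough to find
    ultrafilters [x_i], indexed by the subsets of [nat], such that for every [h]
    in [S] some [h[x_i]] is none of the [x_j], together with an embedding [e] for
    which an ultrafilter has a nonzero lower bound exactly when it is one of the
    [x_i].

    The [x_i] are chosen by recursion along an order of type omega_1: no
    ultrafilter is countably generated, so below any nonzero element countably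
    many ultrafilters can be avoided.

    For [e], enlarge the algebra of clopen sets of the Stone space of [B] by
    doubling every point and allowing the copies of finitely many [x_i] to be
    removed or added; each copy of an [x_i] then becomes an atom. This algebra is
    embedded in P(N)/fin by recursion of length omega_1. At stage [C] (an
    arbitrary subset of [nat]) the part [R] already embedded is countable. Either
    the sets of [R] whose image almost contains [C] leave some set of the algebra
    undecided, and then the image of that set can be chosen to split [C]; or they
    generate every ultrafilter containing them, so such an ultrafilter is
    countably generated. *)

(** * Recursion of length omega_1 *)

Lemma card_le_range I V (A : set V) v0 :
  A v0 -> A #<= [set: I] -> exists k : I -> V, range k = A.
Proof.
move=> Av0 /pfcard_geP[A0|/unsquash f]; first by rewrite A0 in Av0.
exists f; apply/seteqP; split=> [_ [i _ <-]|v]; first exact: funS.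
by move=> /(@surj _ _ _ _ f).
Qed.

Lemma countableU T (A A' : set T) :
  countable A -> countable A' -> countable (A `|` A').
Proof.
by move=> cA cA'; rewrite -bigcup2E; apply: bigcup_countable => // -[|[|i]] _.
Qed.

(** A well-founded relation has no cycles, so trichotomy makes it a strict well-order; countable
    initial segments bound its order type by omega_1. *)
Record omega1_order I (lt : I -> I -> Prop) : Prop := Omega1Order {
  omega1_wf : well_founded lt;
  omega1_total : forall i j, lt i j \/ i = j \/ lt j i;
  omega1_countable : forall i, countable [set j | lt j i] }.

Lemma strict_well_order (T : eqType) : exists lt : T -> T -> Prop,
  well_founded lt /\ forall i j, lt i j \/ i = j \/ lt j i.
Proof.
have [le wo] := well_ordering_principle T.
have least (P : T -> Prop) x : P x -> exists2 z, P z & forall y, P y -> le z y.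
  move=> Px; have [|z [[Pz zP] _]] := wo [pred y | `[< P y >]].
    by exists x; apply/asboolP.
  exists z; first exact/asboolP.
  by move=> y Py; apply: zP; apply/asboolP.
have anti i j : le i j -> le j i -> i = j.
  move=> ij ji; apply: (@wo_chain_antisymmetric _ le predT) => //.
    by move=> A _; exact: wo.
  by rewrite ij ji.
exists (fun i j => ~~ le j i); split.
- move=> x; apply: contrapT => nx.
  have [z nz zP] := @least (fun x => ~ Acc (fun i j => ~~ le j i) x) x nx.
  apply: nz; constructor => y yz; apply: contrapT => /zP.
  exact/negP.
- move=> i j; have [ij|/negP ji] := pselect (le i j); last by right; right.
  have [ji|/negP] := pselect (le j i); last by left.
  by right; left; apply: anti.
Qed.

(** A well-order of [set nat] serves if all its initial segments are countable; otherwise it is cut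
    at the least point with uncountably many predecessors. *)
Lemma ch_order : CH -> exists lt : set nat -> set nat -> Prop, omega1_order lt.
Proof.
move=> ch; have [lt [wf tot]] := strict_well_order (set nat).
have [cnt|] := pselect (forall i, countable [set j | lt j i]).
  by exists lt; constructor.
move=> /existsNP[i0 /[dup] ni0].
elim/(well_founded_ind wf) : i0 ni0 => i0 IH ni0 _.
have [[i [ii0 ni]]|h] := pselect (exists i, lt i i0 /\ ~ countable [set j | lt j i]).
  exact: (IH i).
(* All proper initial segments of the uncountable segment below [i0] are
   countable, and [CH] makes that segment equinumerous to [set nat]. *)
have {}h i : lt i i0 -> countable [set j | lt j i].
  by move=> ii0; apply: contrapT => ni; apply: h; exists i.
have /(card_esym) /card_set_bijP[f [/= f1 f2 _]] : [set j | lt j i0] #= [set: set nat].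
  by have [] := ch [set j | lt j i0].
exists (fun i j => lt (f i) (f j)); constructor.
- exact: Inverse_Image.wf_inverse_image.
- move=> i j; have [|[|]] := tot (f i) (f j); [by left| |by right; right].
  by move=> e; right; left; apply: f2 => //; rewrite inE.
- move=> i; apply: (@card_le_trans _ _ _ [set j | lt j (f i)]); last first.
    exact/h/f1.
  apply: (@card_le_trans _ _ _ (f @` [set j | lt (f j) (f i)])).
    suff /card_eqPle[] : f @` [set j | lt (f j) (f i)] #= [set j | lt (f j) (f i)] by [].
    by apply: inj_card_eq => x y _ _; apply: f2; rewrite inE.
  by apply: subset_card_le => _ [j hj <-].
Qed.

Lemma ch_recursion I (lt : I -> I -> Prop) (V : Type) (Q : set V -> I -> V -> Prop) :
  omega1_order lt ->
  (forall K i, countable K -> exists v, Q K i v) ->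
  exists f : I -> V, forall i, Q (f @` [set j | lt j i]) i (f i).
Proof.
move=> [wf _ cnt] H.
(* [choice] needs a value for every [p]; when [p.1] is uncountable an arbitrary one is borrowed from
   [H set0]. *)
have H' (p : set V * I) : exists v, countable p.1 -> Q p.1 p.2 v.
  have [c|nc] := pselect (countable p.1); first by have [v] := H _ p.2 c; exists v.
  by have [v _] := H set0 p.2 (countable0 _); exists v.
have [g gP] := choice H'.
pose F i (rec : forall j, lt j i -> V) :=
  g ([set v | exists j (ji : lt j i), v = rec j ji], i).
pose f := Fix wf (fun=> V) F.
have fE i : f i = g (f @` [set j | lt j i], i).
  rewrite /f Fix_eq; last first.
    move=> {}i r1 r2 e; rewrite /F; congr (g (_, _)).
    by apply/seteqP; split=> v [j [ji ->]]; exists j, ji; rewrite e.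
  rewrite {1}/F; congr (g (_, _)).
  by apply/seteqP; split=> [v [j [ji ->]]|v [j ji <-]]; [exists j|exists j, ji].
exists f => i; rewrite fE; apply: (gP (_, _)).
exact: card_le_trans (card_image_le _ _) (cnt i).
Qed.

Lemma finite_natP (A : set nat) :
  finite_set A <-> exists N, forall x, A x -> (x < N)%N.
Proof.
split=> [|[N AN]]; last first.
  by apply: sub_finite_set (finite_II N) => x /AN.
move=> /finite_seqP[s ->]; exists (\max_(i <- s) i).+1 => x /= xs.
by rewrite ltnS; apply: (@leq_bigmax_seq _ s xpredT id).
Qed.

Lemma infinite_natP (A : set nat) :
  infinite_set A <-> forall N, exists2 x, A x & (N <= x)%N.
Proof.
split=> [iA N|H /finite_natP[N AN]].
  apply: contrapT => nx; apply: iA; apply/finite_natP; exists N => x Ax.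
  by rewrite ltnNge; apply/negP => Nx; apply: nx; exists x.
by have [x /AN] := H N; rewrite ltnNge => /negP.
Qed.

(** * Extending a countable embedding into P(N)/fin *)

(** This is the argument that P(N)/fin has no countable gaps, with points picked along the way so
    that [E] meets each [Z k], and its complement each [W k], infinitely often. *)
Lemma separation_seq (L M Z W : nat -> set nat) :
  (forall i j, finite_set (L i `&` M j)) ->
  (forall k s, infinite_set (Z k `\` \bigcup_(i in `I_s) L i)) ->
  (forall k s, infinite_set (W k `\` \bigcup_(i in `I_s) M i)) ->
  exists E : set nat, [/\ forall n, finite_set (L n `&` E),
    forall n, finite_set (M n `\` E),
    forall k, infinite_set (Z k `&` E) & forall k, infinite_set (W k `\` E)].
Proof.
move=> LM hZ hW.
(* [kap] takes every value infinitely often, so each [Z k] and each [W k] supplies infinitely many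
   picks. *)
pose kap s := oapp fst 0 (unpickle s : option (nat * nat)).
have kapP k N : exists2 s, kap s = k & (N <= s)%N.
  have [m Nm] := @injective_gtn (fun m => pickle (k, m))
    (fun a b e => congr1 snd (pcan_inj pickleK e)) N.
  by exists (pickle (k, m)); [rewrite /kap pickleK | exact: ltnW].
(* [p] holds the stage and the last pick. Stage [s] avoids [L 0], ..., [L s] with its first pick and
   [M 0], ..., [M s] with its second. *)
have step (p : nat * nat) : exists q : nat * nat,
    [/\ (Z (kap p.1) `\` \bigcup_(i in `I_p.1.+1) L i) q.1, (p.2 < q.1)%N,
    (W (kap p.1) `\` \bigcup_(i in `I_p.1.+1) M i) q.2 & (q.1 < q.2)%N].
  have /infinite_natP/(_ p.2.+1)[z Zz zp] := hZ (kap p.1) p.1.+1.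
  have /infinite_natP/(_ z.+1)[w Ww wz] := hW (kap p.1) p.1.+1.
  by exists (z, w).
have [g gP] := choice step.
pose q := fix q s := if s is s'.+1 then g (s, (q s').2) else g (0, 0).
pose z s := (q s).1; pose w s := (q s).2.
have zZ s : (Z (kap s) `\` \bigcup_(i in `I_s.+1) L i) (z s).
  by case: s => [|s]; [case: (gP (0, 0)) | case: (gP (s.+1, (q s).2))].
have wW s : (W (kap s) `\` \bigcup_(i in `I_s.+1) M i) (w s).
  by case: s => [|s]; [case: (gP (0, 0)) | case: (gP (s.+1, (q s).2))].
have zw s : (z s < w s)%N.
  by case: s => [|s]; [case: (gP (0, 0)) | case: (gP (s.+1, (q s).2))].
have wz s : (w s < z s.+1)%N by case: (gP (s.+1, (q s).2)).
have wlt s t : (s < t)%N -> (w s < z t)%N.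
  elim: t => // t IH; rewrite ltnS leq_eqVlt => /orP[/eqP->//|/IH h].
  exact: ltn_trans h (ltn_trans (zw t) (wz t)).
have zge s : (s <= z s)%N.
  elim: s => // s IH; apply: leq_ltn_trans IH _.
  exact: ltn_trans (zw s) (wz s).
have zNw s t : z s <> w t.
  have [st|/wlt ts] := leqP s t; last by move=> e; rewrite e ltnn in ts.
  suff : (z s < w t)%N by move=> h e; rewrite e ltnn in h.
  move: st; rewrite leq_eqVlt => /orP[/eqP->//|/wlt h].
  exact: ltn_trans (zw s) (ltn_trans h (zw t)).
(* The picks interleave, so no [z s] is a [w t]. As [z s] avoids [L i] and [w s]
   avoids [M i] for [i <= s], only finitely many [z s] lie in a given [L n], and
   only finitely many [w s] in a given [M n]. *)
exists [set x | (exists s, x = z s) \/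
  exists n, [/\ M n x, forall i, (i < n.+1)%N -> ~ L i x & forall s, x <> w s]].
split=> [n|n|k|k].
- apply: (@sub_finite_set _ _
    (z @` `I_n `|` \bigcup_(j in `I_n) (L n `&` M j))).
    move=> x [Lx [[s xs]|[j [Mx nL _]]]].
      left; exists s => //=; rewrite ltnNge; apply/negP => ns.
      have [_ []] := zZ s; exists n; [by rewrite /= ltnS|by rewrite -xs].
    right; exists j => //=; rewrite ltnNge; apply/negP => nj.
    exact: (nL n).
  by rewrite finite_setU; split;
    [exact: finite_image|exact: bigcup_finite].
- apply: (@sub_finite_set _ _
    (w @` `I_n `|` \bigcup_(i in `I_n.+1) (L i `&` M n))).
    move=> x [Mx nE].
    have [[i [ni Lx]]|nL] := pselect (exists i, (i < n.+1)%N /\ L i x).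
      by right; exists i.
    have [[s xs]|nw] := pselect (exists s, x = w s).
      left; exists s => //=; rewrite ltnNge; apply/negP => ns.
      have [_ []] := wW s; exists n; [by rewrite /= ltnS|by rewrite -xs].
    case: nE; right; exists n; split=> // [i ni Lx|s xs].
      by apply: nL; exists i.
    by apply: nw; exists s.
  by rewrite finite_setU; split;
    [exact: finite_image|exact: bigcup_finite].
- apply/infinite_natP => N; have [s <- Ns] := kapP k N.
  exists (z s); last exact: leq_trans Ns (zge s).
  by split; [case: (zZ s)|left; exists s].
- apply/infinite_natP => N; have [s <- Ns] := kapP k N.
  exists (w s); last exact: leq_trans Ns (leq_trans (zge s) (ltnW (zw s))).
  split; first by case: (wW s).
  by move=> [[t]|[n [_ _ /(_ s)]]//] /esym /zNw.
Qed.

(* The graph of an embedding into P(N)/fin of an algebra of subsets of [T], kept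
   as a relation between sets and representatives so that unions of chains and
   the adjunction of one pair need no choice of representatives. *)
Record fin_graph T (R : set (set T * set nat)) : Prop := FinGraph {
  fin_graphT : R (setT, setT);
  fin_graphC : forall A E, R (A, E) -> R (~` A, ~` E);
  fin_graphI : forall A E A' E',
    R (A, E) -> R (A', E') -> R (A `&` A', E `&` E');
  fin_graph0 : forall A E, R (A, E) -> A = set0 <-> finite_set E }.

Section FinGraph.
Context {T : Type} (R : set (set T * set nat)) (okR : fin_graph R).

Lemma fin_graphD A E A' E' : R (A, E) -> R (A', E') -> R (A `\` A', E `\` E').
Proof. by rewrite !setDE => h /(fin_graphC okR); exact: fin_graphI. Qed.

Lemma fin_graphU A E A' E' : R (A, E) -> R (A', E') -> R (A `|` A', E `|` E').
Proof.
move=> /(fin_graphC okR) h /(fin_graphC okR) h'.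
by have := fin_graphC okR (fin_graphI okR h h'); rewrite !setCI !setCK.
Qed.

Lemma fin_graph_set0 : R (set0, set0).
Proof. by have := fin_graphC okR (fin_graphT okR); rewrite !setCT. Qed.

Lemma fin_graph_bigcup (P : nat -> set T * set nat) s :
  (forall i, R (P i)) ->
  R (\bigcup_(i in `I_s) (P i).1, \bigcup_(i in `I_s) (P i).2).
Proof.
move=> RP; elim: s => [|s IH]; first by rewrite II0 !bigcup_set0; exact: fin_graph_set0.
rewrite IIS !bigcup_setU !bigcup_set1; apply: fin_graphU => //.
by rewrite -surjective_pairing.
Qed.

Lemma fin_graph_disj A E A' E' : R (A, E) -> R (A', E') ->
  A `&` A' = set0 <-> finite_set (E `&` E').
Proof. by move=> h h'; exact: (fin_graph0 okR (fin_graphI okR h h')). Qed.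

Lemma fin_graph_sub A E A' E' : R (A, E) -> R (A', E') ->
  A `<=` A' <-> finite_set (E `\` E').
Proof.
move=> h h'; rewrite -(fin_graph0 okR (fin_graphD h h')).
by rewrite setD_eq0.
Qed.

End FinGraph.

(** The requirements on [E] are countably many and fit [separation_seq]: [l] lists the sets disjoint
    from [A], [m] those inside [A], while [z] and [w] list the images of the sets meeting [A] and
    its complement, together with [K]. *)
Lemma fin_graph_extend T (R : set (set T * set nat)) (A : set T) (K : set (set nat)) :
  fin_graph R -> countable R -> countable K ->
  (forall C P Q, K C -> R (P, Q) -> finite_set (C `\` Q) ->
    P `&` A !=set0 /\ P `\` A !=set0) ->
  exists E, (forall P Q, R (P, Q) ->
      [/\ P `&` A = set0 <-> finite_set (Q `&` E)
        & P `\` A = set0 <-> finite_set (Q `\` E)]) /\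
    forall C, K C -> infinite_set (C `&` E) /\ infinite_set (C `\` E).
Proof.
move=> okR cR cK splitK; have R0 := fin_graph_set0 okR; have RT := fin_graphT okR.
(* For trivial [A] the pair [(setT, setT)] would violate the hypothesis on any member of [K], so [K]
   is empty. *)
have noK : A = set0 \/ A = setT -> forall C, ~ K C.
  move=> A0 C KC; have : finite_set (C `\` setT) by rewrite setDT; exact: finite_set0.
  move=> /(splitK C setT setT KC RT)[].
  by case: A0 => ->; [rewrite setI0 => -[]|rewrite setDT => _ []].
have [A0|/eqP/set0P[a Aa]] := pselect (A = set0).
  exists set0; split=> [P Q h|C /noK]; last by case; left.
  rewrite A0 !setI0 !setD0; split; last exact: (fin_graph0 okR h).
  by split=> // _; exact: finite_set0.
have [AT|nAT] := pselect (A = setT).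
  exists setT; split=> [P Q h|C /noK]; last by case; right.
  rewrite AT !setIT !setDT; split; first exact: (fin_graph0 okR h).
  by split=> // _; exact: finite_set0.
have [b nAb] : exists b, ~ A b.
  by apply/existsNP => hA; apply: nAT; apply/seteqP; split.
have enum (S : set (set T * set nat)) p0 : S p0 -> S `<=` R ->
    exists k : nat -> set T * set nat, range k = S.
  move=> Sp0 SR; apply: (card_le_range Sp0).
  exact: card_le_trans (subset_card_le SR) cR.
have [l lE] := enum [set p | R p /\ p.1 `&` A = set0] _ (conj R0 (set0I _))
  (fun _ => @proj1 _ _).
have [m mE] := enum [set p | R p /\ p.1 `\` A = set0] _ (conj R0 (set0D _))
  (fun _ => @proj1 _ _).
have lP i : [set p | R p /\ p.1 `&` A = set0] (l i) by rewrite -lE; exists i.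
have mP i : [set p | R p /\ p.1 `\` A = set0] (m i) by rewrite -mE; exists i.
have cIm (S : set (set T * set nat)) : S `<=` R -> countable (snd @` S `|` K).
  move=> SR; apply: countableU => //; apply: sub_countable (card_image_le _ _) _.
  exact: sub_countable (subset_card_le SR) cR.
have [||z zE] := @card_le_range nat _
    (snd @` [set p | R p /\ p.1 `&` A !=set0] `|` K) setT.
- by left; exists (setT, setT) => //; split=> //; exists a.
- by apply: cIm => ? [].
have [||w wE] := @card_le_range nat _
    (snd @` [set p | R p /\ p.1 `\` A !=set0] `|` K) setT.
- by left; exists (setT, setT) => //; split=> //; exists b.
- by apply: cIm => ? [].
(* If finitely many images of the [l i] almost covered [C], their union would be the image of a set
   disjoint from [A], against [splitK]. For the [m i] that set would lie inside [A]. *)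
have split2 (c : bool) C s : K C ->
    infinite_set (C `\` \bigcup_(i in `I_s) (if c then l i else m i).2).
  move=> KC fC.
  have Rs : forall i, R (if c then l i else m i).
    by move=> i; case: c {fC}; [case: (lP i)|case: (mP i)].
  have [[x [[i _ Px] Ax]] [y [[j _ Py] nAy]]] :=
    splitK C _ _ KC (fin_graph_bigcup okR s Rs) fC.
  case: c Px Py {Rs fC} => Px Py.
    have [_ e] := lP i; suff : set0 x by []; by rewrite -e.
  have [_ e] := mP j; suff : set0 y by []; by rewrite -e.
have [||k s|E [El Em Ez Ew]] := @separation_seq (snd \o l) (snd \o m) z w.
- move=> i j; have [Ri li] := lP i; have [Rj mj] := mP j.
  rewrite -(fin_graph_disj okR (A := (l i).1) (A' := (m j).1)) -?surjective_pairing //.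
  apply/seteqP; split=> // x [lx mx]; have [Ax|nAx] := pselect (A x).
    by rewrite -li.
  by rewrite -mj.
- move=> k s.
  have : (range z) (z k) by exists k.
  rewrite zE => -[[p [Rp [x [px Ax]]] <-]|Kz]; last exact: (split2 true).
  have Rl := fin_graph_bigcup okR s (fun i => (lP i).1).
  rewrite (surjective_pairing p) in Rp.
  move=> /(fin_graph_sub okR Rp Rl) /(_ x px)[i _ lx].
  by have [_ e] := lP i; suff : set0 x by []; rewrite -e.
- have : (range w) (w k) by exists k.
  rewrite wE => -[[p [Rp [x [px nAx]]] <-]|Kw]; last exact: (split2 false).
  have Rm := fin_graph_bigcup okR s (fun i => (mP i).1).
  rewrite (surjective_pairing p) in Rp.
  move=> /(fin_graph_sub okR Rp Rm) /(_ x px)[i _ mx].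
  by have [_ e] := mP i; suff : set0 x by []; rewrite -e.
exists E; split=> [P Q h|C KC]; last first.
  split.
    have : range z C by rewrite zE; right.
    by move=> [k _ <-].
  have : range w C by rewrite wE; right.
  by move=> [k _ <-].
split; split=> [PA|].
- have : range l (P, Q) by rewrite lE.
  by move=> [i _ li]; have := El i; rewrite /= li.
- apply: contraPP => /eqP/set0P PA.
  have : range z Q by rewrite zE; left; exists (P, Q).
  by move=> [k _ <-].
- have : range m (P, Q) by rewrite mE.
  by move=> [i _ mi]; have := Em i; rewrite /= mi.
- apply: contraPP => /eqP/set0P PA.
  have : range w Q by rewrite wE; left; exists (P, Q).
  by move=> [k _ <-].
Qed.

(** * Adjoining one set to a graph *)

Record set_algebra T (AA : set (set T)) : Prop := SetAlgebra {
  set_algebraT : AA setT;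
  set_algebraC : forall A, AA A -> AA (~` A);
  set_algebraI : forall A A', AA A -> AA A' -> AA (A `&` A') }.

(* The general element of the algebra generated by [A] and a given algebra. *)
Definition splice T (A P P' : set T) := (P `&` A) `|` (P' `\` A).

Lemma spliceC T (A P P' : set T) : ~` splice A P P' = splice A (~` P) (~` P').
Proof.
by apply/seteqP; split=> x; rewrite /splice /setC /setI /setD /setU /=;
  have [|] := pselect (A x); tauto.
Qed.

Lemma spliceI T (A P P' S S' : set T) :
  splice A P P' `&` splice A S S' = splice A (P `&` S) (P' `&` S').
Proof.
by apply/seteqP; split=> x; rewrite /splice /setI /setD /setU /=; tauto.
Qed.

Lemma splice_diag T (A P : set T) : splice A P P = P.
Proof. by rewrite /splice setUIDK. Qed.

Lemma spliceTP T (A : set T) : splice A setT set0 = A.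
Proof. by rewrite /splice setTI set0D setU0. Qed.

Lemma splice_eq0 T (A P P' : set T) :
  splice A P P' = set0 <-> P `&` A = set0 /\ P' `\` A = set0.
Proof.
by rewrite /splice setU_eq0.
Qed.

Lemma set_algebra_splice T (AA : set (set T)) A P P' : set_algebra AA ->
  AA A -> AA P -> AA P' -> AA (splice A P P').
Proof.
move=> aA hA hP hP'; rewrite -[splice _ _ _]setCK.
rewrite /splice setCU; apply/(set_algebraC aA)/(set_algebraI aA);
  apply/(set_algebraC aA); last rewrite setDE; apply/(set_algebraI aA) => //.
exact: (set_algebraC aA).
Qed.

Definition adjoin T (R : set (set T * set nat)) A E : set (set T * set nat) :=
  [set p | exists P Q P' Q', [/\ R (P, Q), R (P', Q')
    & p = (splice A P P', splice E Q Q')]].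

Lemma sub_adjoin T (R : set (set T * set nat)) A E : R `<=` adjoin R A E.
Proof. by move=> [P Q] h; exists P, Q, P, Q; rewrite !splice_diag. Qed.

Lemma countable_adjoin T (R : set (set T * set nat)) A E :
  countable R -> countable (adjoin R A E).
Proof.
move=> cR; apply: (@sub_countable _ _ _ ((fun q => (splice A q.1.1 q.2.1,
  splice E q.1.2 q.2.2)) @` (R `*` R))).
  apply: subset_card_le => _ [P [Q [P' [Q' [h h' ->]]]]].
  by exists ((P, Q), (P', Q')).
exact/(sub_countable (card_image_le _ _))/countableX.
Qed.

(** Complement and intersection act on splices componentwise. A splice is empty, or finite, exactly
    when both its parts are, and the hypothesis compares part with part. *)
Lemma fin_graph_adjoin T (R : set (set T * set nat)) A E : fin_graph R ->
  (forall P Q, R (P, Q) -> [/\ P `&` A = set0 <-> finite_set (Q `&` E)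
    & P `\` A = set0 <-> finite_set (Q `\` E)]) ->
  fin_graph (adjoin R A E) /\ adjoin R A E (A, E).
Proof.
move=> okR hE; split; first split.
- exact/sub_adjoin/(fin_graphT okR).
- move=> _ _ [P [Q [P' [Q' [h h' [-> ->]]]]]]; rewrite !spliceC.
  exists (~` P), (~` Q), (~` P'), (~` Q').
  by split=> //; exact: (fin_graphC okR).
- move=> ? ? ? ? [P [Q [P' [Q' [h h' [-> ->]]]]]].
  move=> [S [U [S' [U' [k k' [-> ->]]]]]]; rewrite !spliceI.
  exists (P `&` S), (Q `&` U), (P' `&` S'), (Q' `&` U').
  by split=> //; exact: (fin_graphI okR).
- move=> _ _ [P [Q [P' [Q' [h h' [-> ->]]]]]].
  rewrite splice_eq0 finite_setU.
  by have [-> _] := hE _ _ h; have [_ ->] := hE _ _ h'.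
exists setT, setT, set0, set0; split; [exact: (fin_graphT okR)|
  exact: (fin_graph_set0 okR)|by rewrite !spliceTP].
Qed.

(** * Countable stages: splitting a set or deciding everything *)

Definition splits (E C : set nat) :=
  infinite_set (C `&` E) /\ infinite_set (C `\` E).

(** For a graph [R], the image of a decided [A] cannot split [C]: modulo finite sets, [C] lies
    inside it or misses it. By [fin_approx_extend] this is the only obstacle to splitting. *)
Definition decides T (R : set (set T * set nat)) (C : set nat) (A : set T) :=
  exists P Q, [/\ R (P, Q), finite_set (C `\` Q)
    & P `&` A = set0 \/ P `\` A = set0].

Record fin_approx T (AA : set (set T)) (R : set (set T * set nat)) : Prop :=
  FinApprox {
  fin_approx_graph : fin_graph R;
  fin_approx_countable : countable R;
  fin_approx_dom : forall A E, R (A, E) -> AA A }.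

Lemma fin_approx_extend T (AA : set (set T)) R A (K : set (set nat)) :
  set_algebra AA -> fin_approx AA R -> AA A -> countable K ->
  (forall C, K C -> ~ decides R C A) ->
  exists E, [/\ fin_approx AA (adjoin R A E), adjoin R A E (A, E)
    & forall C, K C -> splits E C].
Proof.
move=> aA [okR cR domR] AAA cK splitK.
have [|E [hE EK]] := @fin_graph_extend _ R A K okR cR cK.
  move=> C P Q /splitK ndec h fC; split; apply/set0P/eqP => e;
    apply: ndec; exists P, Q; split=> //; tauto.
exists E; have [ok' RA] := fin_graph_adjoin okR hE; split=> //; split=> //.
  exact: countable_adjoin.
move=> _ _ [P [Q [P' [Q' [/domR h /domR h' [-> _]]]]]].
exact: set_algebra_splice.
Qed.

(** [A] is adjoined first, with nothing to split. If the result leaves some [A'] undecided, [A'] is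
    adjoined as well, with an image that splits [C]. *)
Lemma fin_approx_step T (AA : set (set T)) R A C :
  set_algebra AA -> fin_approx AA R -> AA A ->
  exists R', [/\ fin_approx AA R', R `<=` R', exists E, R' (A, E)
    & (exists A' E', R' (A', E') /\ splits E' C) \/
      forall A', AA A' -> decides R' C A'].
Proof.
move=> aA apR AAA.
have [//|E [ap1 RA _]] := @fin_approx_extend _ AA R A set0 aA apR AAA (countable0 _).
have [alldec|/existsNP[A' /not_implyP[AAA' nd]]] :=
  pselect (forall A', AA A' -> decides (adjoin R A E) C A').
  by exists (adjoin R A E); split; [by []|exact: sub_adjoin|exists E|right].
have [_ ->//|E' [ap2 RA' EC]] :=
  @fin_approx_extend _ AA (adjoin R A E) A' [set C] aA ap1 AAA' (countable1 C).
exists (adjoin (adjoin R A E) A' E'); split=> //.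
- by move=> p Rp; do 2 apply: sub_adjoin.
- by exists E; exact: sub_adjoin.
- by left; exists A', E'; split=> //; exact: EC.
Qed.

Definition trivial_graph T : set (set T * set nat) :=
  [set p | p = (setT, setT) \/ p = (set0, set0)].

(** The point [t] keeps [setT] nonempty, as its image, all of [nat], is infinite. *)
Lemma trivial_graph_approx T (AA : set (set T)) (t : T) :
  set_algebra AA -> fin_approx AA (@trivial_graph T).
Proof.
move=> aA; split.
- split=> [|A E|A E A' E'|A E]; first by left.
  + by move=> [[-> ->]|[-> ->]]; [right; rewrite !setCT|left; rewrite !setC0].
  + by move=> [[-> ->]|[-> ->]] [[-> ->]|[-> ->]];
      rewrite ?setIT ?setI0 ?set0I; [left|right|right|right].
  + move=> [[-> ->]|[-> ->]]; last by split=> // _; exact: finite_set0.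
    split=> [e|/infinite_nat//]; suff : set0 t by [].
    by rewrite -e.
- by apply: finite_set_countable; exact: finite_set2.
- move=> A E [[-> _]|[-> _]]; first exact: (set_algebraT aA).
  rewrite -setCT; exact/(set_algebraC aA)/(set_algebraT aA).
Qed.

(** * Unions of chains and the embedding of the whole algebra *)

Lemma fin_graph_chain T (K : set (set (set T * set nat))) :
  K !=set0 -> K `<=` @fin_graph T -> total_on K subset ->
  fin_graph (\bigcup_(R in K) R).
Proof.
move=> [R0 KR0] Kok Ktot; split.
- by exists R0 => //; exact: (fin_graphT (Kok _ KR0)).
- move=> A E [R KR RA]; exists R => //; exact: (fin_graphC (Kok _ KR)).
- move=> A E A' E' [R KR RA] [R' KR' RA'].
  have [h|h] := Ktot _ _ KR KR'.
    by exists R' => //; apply: (fin_graphI (Kok _ KR')) => //; exact: h.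
  by exists R => //; apply: (fin_graphI (Kok _ KR)) => //; exact: h.
- by move=> A E [R KR RA]; exact: (fin_graph0 (Kok _ KR)).
Qed.

Lemma fin_approx_chain T (AA : set (set T)) (K : set (set (set T * set nat))) :
  countable K -> K !=set0 -> K `<=` fin_approx AA -> total_on K subset ->
  fin_approx AA (\bigcup_(R in K) R).
Proof.
move=> cK K0 Kap Ktot; split.
- by apply: fin_graph_chain => // R /Kap [].
- by apply: bigcup_countable => // R /Kap [].
- by move=> A E [R /Kap[_ _ dom] /dom].
Qed.

(** An index [i] plays two roles: stage [i] adjoins the set [a i] and settles the alternative for
    [C = i]. Both outcomes survive to the union, and the countability of stage [C] makes [G]
    countable. *)
Lemma fin_graph_total (ch : CH) T (t : T) (AA : set (set T)) :
  set_algebra AA -> AA #<= [set: set nat] ->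
  exists R, [/\ fin_graph R, forall A E, R (A, E) -> AA A,
    forall A, AA A -> exists E, R (A, E)
    & forall C, (exists A E, R (A, E) /\ splits E C) \/
      exists G : set (set T), [/\ countable G,
        forall P, G P -> exists2 Q, R (P, Q) & finite_set (C `\` Q)
        & forall A, AA A -> exists2 P, G P & P `&` A = set0 \/ P `\` A = set0]].
Proof.
move=> aA /(card_le_range (set_algebraT aA))[a aE].
have aAA i : AA (a i) by rewrite -aE; exists i.
have [lt om] := ch_order ch.
(* The recursion asks for a value at every countable [K], so the requirement is conditional on [K]
   being a chain of approximations; [f_mono] shows by induction that the earlier stages form one. *)
have [|f fP] := @ch_recursion _ lt (set (set T * set nat)) (fun K i R' =>
    K `<=` fin_approx AA -> total_on K subset ->
    [/\ fin_approx AA R', forall R, K R -> R `<=` R', exists E, R' (a i, E)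
    & (exists A' E', R' (A', E') /\ splits E' i) \/
      forall A', AA A' -> decides R' i A']) om.
  move=> K i cK.
  have [Kap|nK] := pselect (K `<=` fin_approx AA); last by exists set0 => /nK.
  have [Ktot|nK] := pselect (total_on K subset); last by exists set0 => _ /nK.
  have [R0 [apR0 KR0]] : exists R0, fin_approx AA R0 /\ forall R, K R -> R `<=` R0.
    have [K0|/set0P K0] := eqVneq K set0.
      exists (@trivial_graph T); split; first exact: trivial_graph_approx.
      by rewrite K0.
    exists (\bigcup_(R in K) R); split; first exact: fin_approx_chain.
    by move=> R KR p Rp; exists R.
  have [R' [apR' R0R' RE dec]] := fin_approx_step i aA apR0 (aAA i).
  exists R' => _ _; split=> // R /KR0 h; exact: subset_trans h R0R'.
have f_mono i : fin_approx AA (f i) /\ forall j, lt j i -> f j `<=` f i.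
  elim/(well_founded_ind (omega1_wf om)) : i => i IH.
  have [||ap h _ _] := fP i.
  - by move=> _ [j ji <-]; case: (IH j ji).
  - move=> _ _ [j ji <-] [k ki <-].
    have [jk|[->|kj]] := omega1_total om j k; [left|by left|right].
      by case: (IH k ki) => _; apply.
    by case: (IH j ji) => _; apply.
  by split=> // j ji; apply: h; exists j.
have {}fP i : (exists E, f i (a i, E)) /\
    ((exists A' E', f i (A', E') /\ splits E' i) \/
      forall A', AA A' -> decides (f i) i A').
  have [||] := fP i => //.
  - by move=> _ [j ji <-]; case: (f_mono j).
  - move=> _ _ [j ji <-] [k ki <-].
    have [jk|[->|kj]] := omega1_total om j k; [left|by left|right].
      by case: (f_mono k) => _; apply.
    by case: (f_mono j) => _; apply.
exists (\bigcup_(R in range f) R); split.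
- apply: fin_graph_chain; first by exists (f set0); exists set0.
    by move=> _ [i _ <-]; case: (f_mono i) => -[].
  move=> _ _ [j _ <-] [k _ <-].
  have [jk|[->|kj]] := omega1_total om j k; [left|by left|right].
    by case: (f_mono k) => _; apply.
  by case: (f_mono j) => _; apply.
- by move=> A E [_ [i _ <-]]; case: (f_mono i) => -[_ _ dom] _ /dom.
- move=> A; rewrite -aE => -[i _ <-]; have [[E fE] _] := fP i.
  by exists E; exists (f i) => //; exists i.
- move=> C; have [_ [[A' [E' [fE CE]]]|dec]] := fP C.
    by left; exists A', E'; split=> //; exists (f C) => //; exists C.
  right; exists (fst @` [set p | f C p /\ finite_set (C `\` p.2)]); split.
  + apply: sub_countable (card_image_le _ _) _.
    apply: sub_countable (subset_card_le _) (fin_approx_countable (f_mono C).1).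
    by move=> p [].
  + move=> _ [[P Q] [fPQ /= CQ] <-]; exists Q => //.
    by exists (f C) => //; exists C.
  + move=> A /dec[P [Q [fPQ CQ PA]]]; exists P => //.
    by exists (P, Q).
Qed.

(** * Ultrafilters *)

Section Ultrafilters.
Context {d : Order.disp_t} {B : ctbDistrLatticeType d}.
Implicit Types (U F : set B) (a b c : B).

Lemma compl_meet_le a b : (a `&` ~` b)%O = \bot%O -> (a <= b)%O.
Proof. by move/eqP; rewrite disj_leC complK. Qed.

(** Maximality is applied to the filter generated by [U] and [b], which is improper only if the
    complement of [b] is in [U]. *)
Lemma ultrafilterN U b : boolean_ultrafilter U -> U (~` b)%O <-> ~ U b.
Proof.
move=> [[[UT UI US] U0] Umax]; split=> [Unb Ub|nUb].
  by apply: U0; rewrite -(meetxC b); exact: UI.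
apply: contrapT => nUnb.
pose F := [set x | exists2 u, U u & (u `&` b <= x)%O].
have UF : U `<=` F by move=> u Uu; exists u => //; exact: leIl.
suff pF : proper_boolean_filter F.
  by apply: nUb; rewrite -(Umax F pF UF); exists \top%O => //; exact: leIr.
split; first split.
- exact: UF.
- move=> x y [u Uu ux] [v Uv vy]; exists (u `&` v)%O; first exact: UI.
  rewrite lexI (le_trans _ ux) ?(le_trans _ vy) //.
    by rewrite leI2 ?leIr.
  by rewrite leI2 ?leIl.
- by move=> x y xy [u Uu ux]; exists u => //; exact: le_trans xy.
move=> [u Uu]; rewrite lex0 => /eqP ub; apply: nUnb.
by apply: US Uu; apply: compl_meet_le; rewrite complK.
Qed.

Lemma prime_ultrafilter F : proper_boolean_filter F ->
  (forall b, F b \/ F (~` b)%O) -> boolean_ultrafilter F.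
Proof.
move=> pF prF; split=> // G [[GT GI GS] G0] FG; apply/seteqP; split=> // b Gb.
have [//|/FG Gnb] := prF b; case: G0; rewrite -(meetxC b); exact: GI.
Qed.

Lemma ultrafilter_extension F : proper_boolean_filter F ->
  exists2 U, boolean_ultrafilter U & F `<=` U.
Proof.
(* [Zorn_bigcup] also tests the empty chain, whose union is empty; joining [F] to every [X] turns
   that case into [F] itself. *)
move=> pF; have [|X [pX maxX]] := @Zorn_bigcup _
    [set X | proper_boolean_filter (F `|` X)].
  move=> K Kp Ktot; split; first split.
  - by left; case: pF => -[].
  - move=> x y; have [[FT FI FS] _] := pF.
    have incl X Y z : X `<=` Y -> (F `|` X) z -> (F `|` Y) z.
      by move=> XY [|/XY]; [left|right].
    have all2 : (F `|` \bigcup_(X in K) X) x -> (F `|` \bigcup_(X in K) X) y ->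
        (F x /\ F y) \/ exists2 X, K X & (F `|` X) x /\ (F `|` X) y.
      move=> [Fx|[X KX Xx]] [Fy|[Y KY Yy]]; first by left.
      + by right; exists Y => //; split; [left|right].
      + by right; exists X => //; split; [right|left].
      + right; have [XY|YX] := Ktot _ _ KX KY.
          by exists Y => //; split; right => //; exact: XY.
        by exists X => //; split; right => //; exact: YX.
    move=> hx hy; have [[Fx Fy]|[X KX [Xx Xy]]] := all2 hx hy.
      by left; exact: FI.
    apply: (incl X); first by move=> z Xz; exists X.
    by have [[_ XI _] _] := Kp _ KX; exact: XI.
  - move=> x y xy [Fx|[X KX Xx]].
      by left; have [[_ _ FS] _] := pF; exact: FS Fx.
    have [[_ _ XS] _] := Kp _ KX.
    by case: (XS _ _ xy (or_intror Xx)) => h; [left|right; exists X].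
  - move=> [F0|[X KX X0]]; first by case: pF.
    by case: (Kp _ KX) => _; apply; right.
exists (F `|` X); last by move=> x; left.
split=> // G pG FXG; apply/seteqP; split=> // x Gx; right.
have [//|nXx] := pselect (X x).
have XG : X `<` G.
  split; last by move=> /(_ x Gx).
  by move=> z Xz; apply: FXG; right.
case: (maxX _ XG); rewrite /= setUidr //.
by move=> z Fz; apply: FXG; left.
Qed.

Lemma ultrafilter_principal_extension c : c != \bot%O ->
  exists2 U, boolean_ultrafilter U & U c.
Proof.
move=> c0; have [|U uU cU] := @ultrafilter_extension [set x | (c <= x)%O].
  split; first split.
  - exact: lex1.
  - by move=> x y cx cy; rewrite /= lexI cx.
  - by move=> x y xy cx; exact: le_trans xy.
  - by rewrite /= lex0; exact/negP.
by exists U => //; apply: cU => /=.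
Qed.

Lemma filter_generated_sub U G : boolean_filter U -> G `<=` U ->
  (forall b, U b -> exists2 g, G g & (g <= b)%O) -> U = filter_generated G.
Proof.
move=> fU GU h; apply/seteqP; split=> [b /h[g Gg gb] F [fF GF]|b].
  by apply: (boolean_filterS fF gb); exact: GF.
by apply.
Qed.

Hypothesis uB : ultrafilter_number_uncountable B.

(** Otherwise all nonzero elements below [c] are in [U]. Then [c] is below every [b] in [U], since
    [U] cannot contain the part of [c] outside [b], and [c] alone generates [U]. *)
Lemma ultrafilter_shrink U c : boolean_ultrafilter U -> c != \bot%O ->
  exists c', [/\ c' != \bot%O, (c' <= c)%O & ~ U c'].
Proof.
move=> uU c0; apply: contrapT => H.
have {}H c' : c' != \bot%O -> (c' <= c)%O -> U c'.
  by move=> h1 h2; apply: contrapT => nU; apply: H; exists c'.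
have [[[UT UI US] U0] _] := uU.
apply: (uB uU); exists [set c]; split; first exact: countable1.
apply: filter_generated_sub => //; first by move=> _ ->; exact: H.
move=> b Ub; exists c => //; apply: compl_meet_le; apply/eqP.
apply: contrapT => /negP /H/(_ (leIl _ _)) h; apply: U0.
rewrite -(meetxC b); apply: UI => //; apply: US h; exact: leIr.
Qed.

(** Diagonalization: [c] is shrunk step by step out of the ultrafilters in [K], and a decreasing
    sequence of nonzero elements generates a proper filter. *)
Lemma ultrafilter_avoid (K : set (set B)) c : countable K ->
  K `<=` boolean_ultrafilter -> c != \bot%O ->
  exists U, [/\ boolean_ultrafilter U, U c & ~ K U].
Proof.
move=> cK uK c0; have [K0|/set0P[V0 KV0]] := eqVneq K set0.
  by have [U uU Uc] := ultrafilter_principal_extension c0; exists U; split=> //; rewrite K0.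
have [k kE] := card_le_range KV0 cK.
have uk n : boolean_ultrafilter (k n) by apply: uK; rewrite -kE; exists n.
have step (p : nat * B) : exists c', p.2 != \bot%O ->
    [/\ c' != \bot%O, (c' <= p.2)%O & ~ k p.1 c'].
  have [->|p0] := eqVneq p.2 \bot%O; first by exists \bot%O.
  by have [c' h] := ultrafilter_shrink (uk p.1) p0; exists c'.
have [g gP] := choice step.
(* [s n.+1] is not in the [n]-th ultrafilter of [K]. *)
pose s := fix s n := if n is n'.+1 then g (n', s n') else c.
have s0 n : s n != \bot%O by elim: n => //= n IH; have [] := gP (n, s n) IH.
have sS n : (s n.+1 <= s n)%O /\ ~ k n (s n.+1).
  by have [] := gP (n, s n) (s0 n).
have sle m n : (m <= n)%N -> (s n <= s m)%O.
  elim: n => [|n IH]; first by rewrite leqn0 => /eqP->.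
  rewrite leq_eqVlt => /orP[/eqP->//|]; rewrite ltnS => /IH h.
  exact: le_trans (sS n).1 h.
have [|U uU sU] := @ultrafilter_extension [set x | exists n, (s n <= x)%O].
  split; first split.
  - by exists 0; exact: lex1.
  - move=> x y [m mx] [n ny]; exists (maxn m n); rewrite lexI.
    by rewrite (le_trans _ mx) ?(le_trans _ ny) ?sle ?leq_maxl ?leq_maxr.
  - by move=> x y xy [n nx]; exists n; exact: le_trans xy.
  - by move=> [n]; rewrite lex0; exact/negP.
exists U; split=> //; first by apply: sU; exists 0.
rewrite -kE => -[n _ kU]; have [_ []] := sS n; rewrite kU.
by apply: sU; exists n.+1.
Qed.

Lemma image_ultrafilter h U : boolean_aut B h -> boolean_ultrafilter U ->
  boolean_ultrafilter (h @` U).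
Proof.
move=> [[hI hU hC h0 h1] [g gh hg]] uU; have [[[UT UI US] U0] _] := uU.
apply: prime_ultrafilter; first split; first split.
- by exists \top%O.
- by move=> _ _ [x Ux <-] [y Uy <-]; exists (x `&` y)%O; [exact: UI|exact: hI].
- move=> z y zy [x Ux xz]; exists (g y); last exact: hg.
  apply: US Ux; apply/meet_idPl/(can_inj gh).
  by rewrite hI xz hg; apply/meet_idPl.
- move=> [x Ux hx]; apply: U0; rewrite -(gh \bot%O) h0.
  by rewrite -hx gh.
move=> b; have [Ub|nUb] := pselect (U (g b)).
  by left; exists (g b) => //; exact: hg.
right; exists (~` (g b))%O; first by apply/(ultrafilterN _ uU).
by rewrite hC hg.
Qed.

Lemma aut_moves h : boolean_aut B h -> h <> idfun ->
  exists2 c, c != \bot%O &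
    forall U, boolean_ultrafilter U -> U c -> h @` U <> U.
Proof.
move=> [[hI hU hC h0 h1] [g gh hg]] hid.
(* If [b] were always below [h b], the same for complements would give the reverse inequality, hence
   [h = idfun]. *)
have [b hb] : exists b, ~ (b <= h b)%O.
  apply: contrapT => H; apply: hid; apply/funext => b /=.
  have {}H x : (x <= h x)%O by apply: contrapT => nx; apply: H; exists x.
  apply/eqP; rewrite eq_le H andbT -leC -hC; exact: H.
exists (b `&` ~` h b)%O.
  by apply/negP => /eqP/compl_meet_le.
move=> U uU; have [[[UT UI US] U0] _] := uU => Uc e.
have Ub : U b by apply: US Uc; exact: leIl.
have : U (~` h b)%O by apply: US Uc; exact: leIr.
by move/(ultrafilterN _ uU); apply; rewrite -e; exists b.
Qed.

End Ultrafilters.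

(** * Ultrafilters moved outside the chosen family *)

(** The recursion stores each ultrafilter with its image under [s i]. A coincidence between the
    image of one and another is excluded at the later of the two stages. *)
Lemma moved_ultrafilters (ch : CH) (d : Order.disp_t) (B : ctbDistrLatticeType d)
    (S : set (B -> B)) :
  \top%O != \bot%O :> B -> ultrafilter_number_uncountable B ->
  S `<=` boolean_aut B `\` [set idfun] -> S #<= [set: set nat] ->
  exists x : set nat -> set B, (forall i, boolean_ultrafilter (x i)) /\
    forall h, S h -> exists i, forall j, h @` (x i) <> x j.
Proof.
move=> B1 uB autS sizeS; have [S0|/set0P[h0 Sh0]] := eqVneq S set0.
  have [U uU _] := ultrafilter_principal_extension B1.
  by exists (fun=> U); split=> // h; rewrite S0.
have [s sE] := card_le_range Sh0 sizeS.
have {}autS i : boolean_aut B (s i) /\ s i <> idfun by apply: autS; rewrite -sE; exists i.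
have [lt om] := ch_order ch.
have [|f fP] := @ch_recursion _ lt (set B * set B) (fun K i v =>
   [/\ boolean_ultrafilter v.1, v.2 = s i @` v.1, v.2 <> v.1,
       ~ (snd @` K) v.1 & ~ (fst @` K) v.2]) om.
  move=> K i cK; have [aut_si si_id] := autS i.
  have [c c0 cP] := aut_moves aut_si si_id.
  (* That the new image is no earlier ultrafilter is expressed as avoiding the preimages of the
     earlier ones. *)
  pose K' := [set U | boolean_ultrafilter U /\
    (snd @` K `|` preimage (s i) @` (fst @` K)) U].
  have [||U [uU Uc nKU]] := @ultrafilter_avoid _ _ uB K' c _ _ c0.
  - apply: (sub_countable (B := snd @` K `|` preimage (s i) @` (fst @` K))).
      by apply: subset_card_le => U [].
    apply: countableU; first exact: sub_countable (card_image_le _ _) cK.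
    apply: sub_countable (card_image_le _ _) _.
    exact: sub_countable (card_image_le _ _) cK.
  - by move=> U [].
  exists (U, s i @` U); split=> //=; first exact: cP.
    by move=> KU; apply: nKU; split=> //; left.
  move=> KU; apply: nKU; split=> //; right; exists (s i @` U) => //.
  apply/seteqP; split=> [b [a Ua ab]|b Ub]; last by exists b.
  by have [_ /bij_inj inj] := aut_si; rewrite -(inj _ _ ab).
exists (fst \o f); split=> [i|h]; first by case: (fP i).
rewrite -sE => -[i _ <-]; exists i => j /=.
have [_ fi2 fi fij _] := fP i; rewrite -fi2.
have [ij|[<-//|ji]] := omega1_total om i j.
  have [_ _ _ + _] := fP j.
  by move=> nj e; apply: nj; exists (f i) => //; exists i.
have [_ _ _ _] := fP i.
by move=> ni e; apply: ni; exists (f j) => //; exists j.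
Qed.

(** * The Stone space with doubled points *)

Lemma rows_surjective (r : nat -> set nat) :
  exists Y : set nat, forall i, [set n | Y (pickle (i, n))] = r i.
Proof.
exists [set v | exists i n, v = pickle (i, n) /\ r i n] => i.
apply/seteqP; split=> n /=; last by exists i, n.
by move=> [i' [n' [/(pcan_inj pickleK) [-> ->]]]].
Qed.

Section Stone.
Context {d : Order.disp_t} {B : ctbDistrLatticeType d}.

Definition stone_space := {U : set B | boolean_ultrafilter U}.
Definition stone (b : B) : set (stone_space * bool) := [set p | sval p.1 b].

Lemma stoneI a b : stone (a `&` b)%O = stone a `&` stone b.
Proof.
apply/seteqP; split=> -[[U uU] i]; rewrite /stone /=;
  have [[[_ UI US] _] _] := uU; last by case; exact: UI.
by move=> Uab; split; apply: US Uab; [exact: leIl|exact: leIr].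
Qed.

Lemma stoneC b : stone (~` b)%O = ~` stone b.
Proof. by apply/seteqP; split=> -[[U uU] i] /(ultrafilterN b uU). Qed.

Lemma stone1 : stone \top%O = setT.
Proof. by apply/seteqP; split=> // -[[U [[[UT UI US] U0] Um]] i]. Qed.

Lemma stone0 : stone \bot%O = set0.
Proof. by apply/seteqP; split=> // -[[U [[Uf U0] Um]] i]. Qed.

Lemma stone_sub a b : stone a `<=` stone b -> (a <= b)%O.
Proof.
move=> ab; apply: compl_meet_le; apply/eqP; apply: contrapT => /negP.
move=> /ultrafilter_principal_extension[U uU Uab].
have [[[_ _ US] _] _] := uU.
have Ua : U a by apply: US Uab; exact: leIl.
have : U (~` b)%O by apply: US Uab; exact: leIr.
move/(ultrafilterN b uU); apply.
exact: (ab (exist _ U uU, true)).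
Qed.

Lemma ultrafilter_neq (U V : set B) : boolean_ultrafilter U -> boolean_ultrafilter V ->
  V <> U -> exists2 c, U c & ~ V c.
Proof.
move=> [_ Umax] [pV _] VU; apply: contrapT => H; apply/VU/Umax => // c Uc.
by apply: contrapT => nVc; apply: H; exists c.
Qed.

(** [c] is a meet of elements of [U], one omitted by each point of [F]. In [fat_embedding] it
    removes the finite difference between a set and its clopen part. *)
Lemma ultrafilter_separate (U : set B) (F : set (stone_space * bool)) :
  boolean_ultrafilter U -> finite_set F -> (forall p, F p -> sval p.1 <> U) ->
  exists2 c, U c & F `&` stone c = set0.
Proof.
move=> uU /finite_setP[n Fn]; have [[[UT UI US] _] _] := uU.
elim: n => [|n IH] in F Fn *.
  move: Fn; rewrite II0 card_eq0 => /eqP -> _.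
  by exists \top%O => //; rewrite set0I.
move: Fn => /eq_cardSP[p Fp /IH {}IH] FU.
have [q [Fq _] /=|c Uc Fc] := IH; first exact: FU.
have [c' Uc' nc'] := ultrafilter_neq uU (proj2_sig p.1) (FU p Fp).
exists (c `&` c')%O; first exact: UI.
rewrite stoneI; apply/seteqP; split=> // q [Fq [qc qc']].
have [e|qp] := pselect (q = p); first by move: qc'; rewrite e.
by rewrite -Fc.
Qed.

End Stone.
Arguments stone_space {d} B.

Section FatPoints.
Context {d : Order.disp_t} {B : ctbDistrLatticeType d}.
Variables (x : set nat -> set B) (ux : forall i, boolean_ultrafilter (x i)).

(** Only copies marked [false] may be altered; those marked [true] always reveal the clopen set that
    an element comes from. *)
Definition fat_point i : stone_space B * bool := (exist _ (x i) (ux i), false).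

(* [A] agrees with the clopen set of [b] except at finitely many of the second
   copies [(x i, false)]. *)
Definition fat_close (b : B) (A : set (stone_space B * bool)) :=
  finite_set (A `+` stone b) /\ A `+` stone b `<=` range fat_point.

Definition fat_algebra : set (set (stone_space B * bool)) :=
  [set A | exists b, fat_close b A].

Lemma fat_close_stone b : fat_close b (stone b).
Proof. by rewrite /fat_close setYK; split=> //; exact: finite_set0. Qed.

Lemma fat_closeC b A : fat_close b A -> fat_close (~` b)%O (~` A).
Proof.
rewrite /fat_close stoneC => h; suff -> : ~` A `+` ~` stone b = A `+` stone b by [].
apply/seteqP; split=> p; rewrite /setY /setD /setC /setU /=;
  have [|] := pselect (A p); have [|] := pselect (stone b p); tauto.
Qed.

Lemma fat_closeI b A b' A' : fat_close b A -> fat_close b' A' ->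
  fat_close (b `&` b')%O (A `&` A').
Proof.
move=> [f s] [f' s']; rewrite /fat_close stoneI.
have sub : (A `&` A') `+` (stone b `&` stone b') `<=`
    (A `+` stone b) `|` (A' `+` stone b').
  move=> p; rewrite /setY /setD /setI /setU /=;
  have [|] := pselect (A p); have [|] := pselect (stone b p);
  have [|] := pselect (A' p); have [|] := pselect (stone b' p); tauto.
split; first by apply: sub_finite_set sub _; rewrite finite_setU.
by apply: subset_trans sub _; rewrite subUset.
Qed.

Lemma fat_algebra_closed : set_algebra fat_algebra.
Proof.
split.
- by exists \top%O; rewrite -stone1; exact: fat_close_stone.
- by move=> A [b h]; exists (~` b)%O; exact: fat_closeC.
- by move=> A A' [b h] [b' h']; exists (b `&` b')%O; exact: fat_closeI.
Qed.

Lemma fat_close_point i : fat_close \bot%O [set fat_point i].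
Proof.
rewrite /fat_close stone0 setY0; split; first exact: finite_set1.
by move=> _ ->; exists i.
Qed.

Lemma fat_algebra_card :
  has_size_continuum B -> fat_algebra #<= [set: set nat].
Proof.
move=> /card_eqPle[sizeB _].
have [beta betaE] := @card_le_range (set nat) _ [set: B] \bot%O I sizeB.
pose row (Y : set nat) (i : nat) := [set n : nat | Y (pickle (i, n))].
(* Row 0 codes the element of [B] and the rows from 2 on list indices of altered points. Row 1
   selects the listed rows in use, none if nothing is altered. *)
pose code Y := stone (beta (row Y 0)) `+`
  (fat_point @` ((fun i => row Y i.+2) @` row Y 1)).
suff sub : fat_algebra `<=` range code.
  exact: card_le_trans (subset_card_le sub) (card_image_le _ _).
move=> A [b [fA sA]]; have : range beta b by rewrite betaE.
move=> [Yb _ Ybb].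
have [N [k NkE]] : exists (N : set nat) (k : nat -> set nat),
    A `+` stone b = fat_point @` (k @` N).
  have [->|/set0P[p0 Ap0]] := eqVneq (A `+` stone b) set0.
    by exists set0, (fun=> set0); rewrite !image_set0.
  have [q qE] := card_le_range Ap0 (finite_set_countable fA).
  have /choice[k kP] n : exists Y, fat_point Y = q n.
    by have [|Y _ e] := sA (q n); [rewrite -qE; exists n|exists Y].
  exists setT, k; rewrite -qE image_comp.
  by apply: eq_imagel => n _; rewrite /= kP.
have [Y YE] := rows_surjective
  (fun i => match i with 0 => Yb | 1 => N | i.+2 => k i end).
exists Y => //; rewrite /code /row !YE Ybb -(eq_imagel (f := k)).
  by rewrite -NkE setYC -setYA setYK setY0.
by move=> i _; rewrite YE.
Qed.

End FatPoints.

(** * The embedding and its lower bounds *)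

Lemma finite_setD_trans T (C E Q : set T) :
  finite_set (C `\` E) -> finite_set (E `\` Q) -> finite_set (C `\` Q).
Proof.
move=> CE EQ; apply: (@sub_finite_set _ _ ((C `\` E) `|` (E `\` Q))).
  by move=> n [Cn nQ]; have [En|nE] := pselect (E n); [right|left].
by rewrite finite_setU.
Qed.

Lemma fin_graph_eqfin T (R : set (set T * set nat)) A E E' :
  fin_graph R -> R (A, E) -> R (A, E') -> \pi_pfin E = \pi_pfin E'.
Proof.
move=> okR h h'; apply/pfin_eqP; rewrite /setY finite_setU.
by split; [exact/(fin_graph_sub okR h h')|exact/(fin_graph_sub okR h' h)].
Qed.

Lemma fat_embedding (ch : CH) (d : Order.disp_t) (B : ctbDistrLatticeType d)
    (x : set nat -> set B) :
  has_size_continuum B -> ultrafilter_number_uncountable B ->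
  (forall i, boolean_ultrafilter (x i)) ->
  exists e : B -> pfin, [/\ boolean_embedding e,
    forall i, exists2 c, c != \bot%O & forall b, x i b -> (c <= e b)%O
    & forall U c, boolean_ultrafilter U -> (forall i, U <> x i) ->
        (forall b, U b -> (c <= e b)%O) -> c = \bot%O].
Proof.
move=> sizeB uB ux; have aA := fat_algebra_closed ux.
pose t := fat_point ux set0.
have [R [okR domR totR decR]] :=
  fin_graph_total ch t aA (fat_algebra_card ux sizeB).
have /choice[E RE] b : exists E, R (stone b, E).
  by apply: totR; exists b; exact: fat_close_stone.
have piE b E' : R (stone b, E') -> \pi_pfin (E b) = \pi_pfin E'.
  exact: fin_graph_eqfin okR (RE b).
exists (fun b => \pi_pfin (E b)); split.
- split; last first.
    move=> a b /pfin_eqP; rewrite /setY finite_setU => -[ab ba].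
    by apply/eqP; rewrite eq_le !stone_sub //; apply/(fin_graph_sub okR).
  split=> [a b|a b|a||].
  + rewrite pfin_meetE; apply: piE; rewrite stoneI; exact: (fin_graphI okR).
  + rewrite pfin_joinE; apply: piE.
    rewrite -[(a `|` b)%O]complK complU stoneC stoneI !stoneC setCI !setCK.
    exact: (fin_graphU okR).
  + rewrite pfin_complE; apply: piE; rewrite stoneC; exact: (fin_graphC okR).
  + rewrite pfin_botE; apply: piE; rewrite stone0; exact: (fin_graph_set0 okR).
  + rewrite pfin_topE; apply: piE; rewrite stone1; exact: (fin_graphT okR).
(* The singleton of [fat_point ux i] is in the algebra and inside [stone b] for every [b] in [x i],
   so its image is the lower bound. *)
- move=> i; have [C RC] : exists C, R ([set fat_point ux i], C).
    by apply: totR; exists \bot%O; exact: fat_close_point.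
  exists (\pi_pfin C).
    apply/eqP; rewrite pfin_botE => /pfin_eqP; rewrite setY0.
    move=> /(fin_graph0 okR RC) e; suff : set0 (fat_point ux i) by [].
    by rewrite -e.
  move=> b xb; apply/pfin_leP; apply/(fin_graph_sub okR RC (RE b)).
  by move=> _ ->.
move=> U; elim/quotW => C uU Ux UC; apply: contrapT => C0.
have {C0} iC : infinite_set C.
  by move=> fC; apply: C0; rewrite pfin_botE; apply/pfin_eqP; rewrite setY0.
have {}UC b : U b -> finite_set (C `\` E b) by move=> /UC /pfin_leP.
(* [A] differs from [stone b] at finitely many points over ultrafilters other than [U]. Some [c] in
   [U] avoids them, so [A] contains the clopen set of the meet of [b] and [c]. *)
have close b A Q : fat_close ux b A -> R (A, Q) -> U b -> finite_set (C `\` Q).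
  move=> [fA sA] RA Ub.
  have [p /sA[i _ <-] /= e|c Uc cA] := ultrafilter_separate uU fA.
    by apply: (Ux i).
  have Ubc : U (b `&` c)%O by have [[[_ UI _] _] _] := uU; exact: UI.
  apply: finite_setD_trans (UC _ Ubc) _.
  apply/(fin_graph_sub okR (RE _) RA); rewrite stoneI => p [bp cp].
  apply: contrapT => nAp; suff : set0 p by [].
  by rewrite -cA; split=> //; right.
have closeN b A Q : fat_close ux b A -> R (A, Q) -> ~ U b -> finite_set (C `&` Q).
  move=> bA RA /(ultrafilterN b uU) Unb.
  have := close _ _ _ (fat_closeC bA) (fin_graphC okR RA) Unb.
  by rewrite setDE setCK.
(* By [close] and [closeN] no image splits [C]. In the other case the clopen parts of the sets in
   [G] will generate [U]. *)
have [[A [E' [RA [CI CD]]]]|[G [cG GC Gdec]]] := decR C.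
  have [b bA] := domR _ _ RA.
  by have [Ub|nUb] := pselect (U b);
    [apply/CD/(close b A)|apply/CI/(closeN b A)].
have /choice[r rP] P : exists b, G P -> fat_close ux b P.
  have [GP|nG] := pselect (G P); last by exists \bot%O => /nG.
  have [Q /domR[b bP] _] := GC P GP; by exists b.
apply: (uB U uU); exists (r @` G).
split; first exact: sub_countable (card_image_le _ _) cG.
have [[fU _] _] := uU.
apply: filter_generated_sub => // [_ [P GP <-]|b Ub].
  apply: contrapT => nUr; apply: iC.
  have [Q RQ CQ] := GC P GP.
  rewrite -(setUIDK C Q) finite_setU; split=> //.
  exact: closeN (rP P GP) RQ nUr.
have [P GP Pb] := Gdec (stone b) (ex_intro _ b (fat_close_stone ux b)).
exists (r P); first by exists P.
have [Q RQ CQ] := GC P GP.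
(* [P] cannot miss [stone b]: the infinite set [C] is almost contained in both their images. *)
have {}Pb : P `<=` stone b.
  case: Pb => [/(fin_graph_disj okR RQ (RE b)) fQ|]; last by rewrite setD_eq0.
  case: iC; rewrite -(setUIDK C (E b)) finite_setU; split; last exact: UC.
  apply: (@sub_finite_set _ _ ((C `\` Q) `|` (Q `&` E b))).
    by move=> n [Cn En]; have [Qn|nQ] := pselect (Q n); [right|left].
  by rewrite finite_setU.
(* The points [(V, true)] are in [range (fat_point ux)] for no [V], so there
   [P] coincides with [stone (r P)]. *)
apply: stone_sub => -[V i] Vr; apply: (Pb (V, true)).
apply: contrapT => nP; have [_ sP] := rP P GP.
by have [] := sP (V, true); first by right.
Qed.

Theorem theorem3p2 (ch : CH) (d : Order.disp_t) (B : ctbDistrLatticeType d)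
    (sizeB : has_size_continuum B) (uB : ultrafilter_number_uncountable B)
    (S : set (B -> B)) (autS : S `<=` boolean_aut B `\` [set idfun])
    (sizeS : S #<= [set: set nat]) :
  exists e : B -> pfin, boolean_embedding e /\
    forall h, S h ->
      ~ exists hbar : pfin -> pfin, boolean_aut pfin hbar /\ hbar \o e = e \o h.
Proof.
(* In a one-element algebra the enumeration [k] would identify [set0] and [setT]. *)
have B1 : \top%O != \bot%O :> B.
  apply/eqP => e; have /card_eqPle[_ le] := sizeB.
  have [k kE] := @card_le_range B _ [set: set nat] set0 I le.
  have allB b : b = \bot%O :> B by apply/eqP; rewrite -lex0 -e lex1.
  have : range k set0 by rewrite kE.
  have : range k setT by rewrite kE.
  move=> [a _ ka] [b _ kb]; suff : [set: nat] 0 -> set0 0 by apply.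
  by rewrite -ka -kb (allB a) (allB b).
have [x [ux xS]] := moved_ultrafilters ch B1 uB autS sizeS.
have [e [emb fat thin]] := fat_embedding ch sizeB uB ux.
exists e; split=> // h Sh [hbar [[[hI _ _ h0 _] /bij_inj inj] he]].
have [i hx] := xS h Sh; have [c c0 cP] := fat i.
move/eqP: c0; apply; apply: inj; rewrite h0.
have [aut_h _] := autS h Sh.
apply: (thin (h @` x i)) => //; first exact: image_ultrafilter.
move=> _ [b xb <-]; have -> : e (h b) = hbar (e b) by rewrite -[RHS]/((hbar \o e) b) he.
by apply/meet_idPl; rewrite -hI; congr hbar; apply/meet_idPl/cP.
Qed.
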